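(* The $W_5$-ColoringExt problem in $S_{2,1,1}$-free graphs can be reduced in polynomial time to the ITTE problem in $S_{2,1,1}$-free graphs. That is, there is a polynomial-time algorithm which, given an instance $(G,U,\varphi)$ of $W_5$-ColoringExt with $G$ being $S_{2,1,1}$-free, outputs an instance $(G^*,X',Y',E')$ of ITTE with $G^*$ being $S_{2,1,1}$-free, such that $(G,U,\varphi)$ is a yes-instance of $W_5$-ColoringExt if and only if $(G^*,X',Y',E')$ is a yes-instance of ITTE.
   Context: All graphs are finite and simple. A graph is $F$-free if it does not contain $F$ as an induced subgraph. $S_{2,1,1}$ is the graph obtained from three disjoint paths on $3$, $2$, $2$ vertices, respectively, by identifying one endvertex of each of them into a single vertex. $W_5$ is the graph obtained from the cycle with consecutive vertices $1,2,3,4,5$ by adding a vertex $0$ adjacent to all of them. An instance of $W_5$-ColoringExt is a triple $(G,U,\varphi)$, where $G$ is a graph, $U\subseteq V(G)$ and $\varphi:U\to V(W_5)$; the question is whether there exists a homomorphism (edge-preserving map) $\psi:G\to W_5$ such that $\psi|_U=\varphi$. Independent Triangle Transversal Extension (ITTE): an instance is a tuple $(G,X',Y',E')$, where $G$ is a graph, $X',Y'\subseteq V(G)$ and $E'\subseteq E(G)$. The question is whether there is an independent set $X\subseteq V(G)$ such that (i) $X'\subseteq X$, (ii) $e\cap X\ne\emptyset$ for every $e\in E'$, (iii) $Y'\cap X=\emptyset$, and (iv) $G-X$ is triangle-free. *)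

(* Defs.v *)
From HB Require Import structures.
From mathcomp Require Import all_boot.
Set Implicit Arguments.
Unset Strict Implicit.
Unset Printing Implicit Defensive.

(** * Finite simple graphs *)

Record sgraph (T : finType) := SGraph {
  adj :> rel T;
  adj_sym : symmetric adj;
  adj_irr : irreflexive adj }.

Section EdgeList.
Variables (n : nat) (l : seq (nat * nat)).
Definition el_adj : rel 'I_n :=
  [rel i j | (i != j) &&
     (((val i, val j) \in l) || ((val j, val i) \in l))].
Lemma el_adj_sym : symmetric el_adj.
Proof. by move=> i j; rewrite /el_adj /= eq_sym orbC. Qed.
Lemma el_adj_irr : irreflexive el_adj.
Proof. by move=> i; rewrite /el_adj /= eqxx. Qed.
Definition el_graph : sgraph 'I_n := SGraph el_adj_sym el_adj_irr.
End EdgeList.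

(* The end 0 is shared by the three paths 0-1-2, 0-3 and 0-4. *)
Definition S211 : sgraph 'I_5 :=
  el_graph 5 [:: (0, 1); (1, 2); (0, 3); (0, 4)].

Definition W5 : sgraph 'I_6 :=
  el_graph 6 [:: (1, 2); (2, 3); (3, 4); (4, 5); (5, 1);
                 (0, 1); (0, 2); (0, 3); (0, 4); (0, 5)].

Definition K3 : sgraph 'I_3 := el_graph 3 [:: (0, 1); (1, 2); (0, 2)].

Definition induced_subgraph (S T : finType) (F : sgraph S) (G : sgraph T) :=
  exists2 f : S -> T, injective f & forall x y, adj G (f x) (f y) = adj F x y.

Definition free (S T : finType) (F : sgraph S) (G : sgraph T) :=
  ~ induced_subgraph F G.

Definition homomorphism (S T : finType) (G : sgraph S) (H : sgraph T)
    (f : S -> T) :=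
  forall x y, adj G x y -> adj H (f x) (f y).

Definition independent (T : finType) (G : sgraph T) (X : {set T}) :=
  forall x y, x \in X -> y \in X -> ~~ adj G x y.

Definition edges (T : finType) (G : sgraph T) : {set {set T}} :=
  [set [set p.1; p.2] | p : T * T & adj G p.1 p.2].

Section DeleteVertices.
Variables (T : finType) (G : sgraph T) (X : {set T}).
Definition delv_adj : rel {x | x \notin X} := [rel x y | adj G (val x) (val y)].
Lemma delv_adj_sym : symmetric delv_adj.
Proof. by move=> x y; rewrite /delv_adj /= adj_sym. Qed.
Lemma delv_adj_irr : irreflexive delv_adj.
Proof. by move=> x; rewrite /delv_adj /= adj_irr. Qed.
Definition delv : sgraph {x | x \notin X} := SGraph delv_adj_sym delv_adj_irr.
End DeleteVertices.

(** * The two problems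

    As inputs of algorithms, graphs have vertex set {0, ..., n-1}. *)

Record w5ext_inst := W5ExtInst {
  we_n : nat;
  we_graph : sgraph 'I_we_n;
  we_dom : {set 'I_we_n};
  we_phi : {v | v \in we_dom} -> 'I_6 }.

Definition w5ext_yes (I : w5ext_inst) : Prop :=
  exists2 psi : 'I_(we_n I) -> 'I_6,
    homomorphism (we_graph I) W5 psi &
    forall u : {v | v \in we_dom I}, psi (val u) = we_phi u.

Record itte_inst := ItteInst {
  it_n : nat;
  it_graph : sgraph 'I_it_n;
  it_in : {set 'I_it_n};
  it_out : {set 'I_it_n};
  it_edges : {set {set 'I_it_n}};
  it_edgesP : it_edges \subset edges it_graph }.

Definition itte_yes (I : itte_inst) : Prop :=
  exists X : {set 'I_(it_n I)},
    [/\ independent (it_graph I) X,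
        it_in I \subset X,
        forall e, e \in it_edges I -> e :&: X != set0,
        it_out I :&: X = set0 &
        free K3 (delv (it_graph I) X)].

(** * Random access machines

    Structured programs over finitely many unbounded arrays of natural numbers
    (cell 0 of an array serves as a register) with a write-only output tape.
    Each assignment, output or test costs 1; an expression occurring in a
    program has fixed size, so charging for each of its operations would change
    running times by a constant factor only.  The arithmetic operations are
    addition and truncated subtraction.  Multiplication is deliberately not
    primitive: without it the bit length of the numbers grows by at most a
    constant per step, so that unit-cost time agrees with Turing machine time up
    to a polynomial.  Output has to be written word by word, so it cannot be
    longer than the running time. *)

Inductive expr :=
  | Const of nat
  | Get of nat & expr
  | Add of expr & expr
  | Sub of expr & expr.

Inductive cmd :=
  | Skip
  | Put of nat & expr & expr
  | Emit of expr
  | Seq of cmd & cmd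
  | If of expr & cmd & cmd
  | While of expr & cmd.

Definition memory := nat -> nat -> nat.

Definition upd (m : memory) (a i v : nat) : memory :=
  fun b j => if (b == a) && (j == i) then v else m b j.

Fixpoint eval (m : memory) (e : expr) : nat :=
  match e with
  | Const k => k
  | Get a e1 => m a (eval m e1)
  | Add e1 e2 => eval m e1 + eval m e2
  | Sub e1 e2 => eval m e1 - eval m e2
  end.

(* [exec c m o t m' o']: started in memory [m] with output tape [o], the program
   [c] halts after [t] steps in memory [m'] with output tape [o']. *)
Inductive exec :
    cmd -> memory -> seq nat -> nat -> memory -> seq nat -> Prop :=
  | ExecSkip m o : exec Skip m o 0 m o
  | ExecPut a e1 e2 m o :
      exec (Put a e1 e2) m o 1 (upd m a (eval m e1) (eval m e2)) o
  | ExecEmit e m o : exec (Emit e) m o 1 m (rcons o (eval m e))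
  | ExecSeq c1 c2 m1 o1 t1 m2 o2 t2 m3 o3 :
      exec c1 m1 o1 t1 m2 o2 -> exec c2 m2 o2 t2 m3 o3 ->
      exec (Seq c1 c2) m1 o1 (t1 + t2) m3 o3
  | ExecIfTrue e c1 c2 m o t m' o' :
      eval m e != 0 -> exec c1 m o t m' o' ->
      exec (If e c1 c2) m o t.+1 m' o'
  | ExecIfFalse e c1 c2 m o t m' o' :
      eval m e = 0 -> exec c2 m o t m' o' ->
      exec (If e c1 c2) m o t.+1 m' o'
  | ExecWhileTrue e c m1 o1 t1 m2 o2 t2 m3 o3 :
      eval m1 e != 0 -> exec c m1 o1 t1 m2 o2 ->
      exec (While e c) m2 o2 t2 m3 o3 ->
      exec (While e c) m1 o1 (t1 + t2).+1 m3 o3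
  | ExecWhileFalse e c m o :
      eval m e = 0 -> exec (While e c) m o 1 m o.

(* The input word is stored in array 0; all other cells contain 0. *)
Definition load (w : seq nat) : memory :=
  fun a i => if a == 0 then nth 0 w i else 0.

(* [f] is computable in polynomial time on the inputs satisfying the promise
   [P], with respect to the encodings [encA] and [encB]. *)
Definition polytime_on (A B : Type) (encA : A -> seq nat) (encB : B -> seq nat)
    (P : A -> Prop) (f : A -> B) : Prop :=
  exists (c : cmd) (k : nat), forall x : A, P x ->
    exists (t : nat) (m : memory),
      exec c (load (encA x)) [::] t m (encB (f x)) /\
      t <= k * (size (encA x)).+1 ^ k.

(** * Encodings of instances *)

Definition enc_rel n (r : rel 'I_n) : seq nat :=
  [seq nat_of_bool (r x y) | x <- enum 'I_n, y <- enum 'I_n].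

Definition enc_set n (A : {set 'I_n}) : seq nat :=
  [seq nat_of_bool (x \in A) | x <- enum 'I_n].

(* A vertex outside the domain of phi is encoded by 0. *)
Definition enc_w5ext (I : w5ext_inst) : seq nat :=
  we_n I :: enc_rel (we_graph I) ++
  [seq (if insub v is Some u then (val (@we_phi I u)).+1 else 0)
     | v <- enum 'I_(we_n I)].

Definition enc_itte (I : itte_inst) : seq nat :=
  it_n I :: enc_rel (it_graph I) ++ enc_set (it_in I) ++ enc_set (it_out I) ++
  enc_rel [rel x y | [set x; y] \in it_edges I].

(* Main.v *)
Require Import Defs.
From mathcomp Require Import all_boot zify.
Set Implicit Arguments.
Unset Strict Implicit.
Unset Printing Implicit Defensive.

(** The graph is kept, and the set X of the target problem plays the role of
    the colour class of the hub 0 of W_5.  Removing it must leave a graph that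
    maps to the rim, a 5-cycle, and a 5-cycle is triangle-free; so the only
    question is which conditions make a triangle-free graph [G - X] map to the
    5-cycle in a way that extends the rim colours prescribed by phi.

    Two vertices with prescribed colours a and b that are joined by a walk of
    length k force a walk of length k from a to b in the 5-cycle. For k = 1
    this says that a and b are adjacent, for k = 2 that they are not adjacent,
    for k = 3 that they are distinct, and for k >= 4 it says nothing. These
    conditions can be expressed in the target problem. Vertices of prescribed
    colour 0 are put in X' and those of prescribed rim colour in Y'; a vertex
    that sees two adjacent rim colours must enter X (k = 2), an edge whose ends
    see a common rim colour must be hit by X (k = 3), and a vertex with a
    prescribed rim colour and a neighbour of a non-adjacent rim colour makes
    the instance infeasible, which is arranged by placing it both in X' and in
    Y' (k = 1).

    The core of the proof is that in a triangle-free and S_{2,1,1}-free graph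
    the three conditions are also sufficient ([consistent_extends]).  One vertex
    is coloured at a time, keeping the conditions.  Take an uncoloured vertex x
    with a coloured neighbour of colour a (if there is none, the coloured
    vertices are separated from the others and any choice works).  Only the two
    neighbours of a on the 5-cycle are candidates; if both are unavailable,
    each is excluded by a coloured vertex at the end of a walk of length at most
    3 from x.  Excluding S_{2,1,1} means that a walk of length two leaving a
    vertex c ends at a neighbour of one of any two neighbours of c
    ([fork_free_leg_attached]).  This connects the two obstructions by short
    walks that contradict the conditions ([obstructions_clash]).

    Polynomial time is shown by an explicit program.  It tabulates which rim
    colours every vertex sees; after that, each output bit is the value of an
    expression of constant size, and two nested loops suffice.  Running times
    and results of programs are derived together, in a Hoare logic for total
    correctness ([hoare]). *)

(** * The 5-cycle *)

Definition C5 : sgraph 'I_5 :=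
  el_graph 5 [:: (0, 1); (1, 2); (2, 3); (3, 4); (4, 0)].

Ltac case_ord i := case: i => -[|[|[|[|[|[|i]]]]]] // ?.

Lemma C5_triangle_free a b c : C5 a b -> C5 b c -> ~~ C5 a c.
Proof. by case_ord a; case_ord b; case_ord c. Qed.

Lemma C5_degree_le2 a b c d : b != c -> C5 a b -> C5 a c -> C5 a d ->
  (d == b) || (d == c).
Proof. by case_ord a; case_ord b; case_ord c; case_ord d. Qed.

Lemma C5_nonneighbours_of_edge a b c d : C5 a b ->
  ~~ C5 a c -> ~~ C5 b c -> ~~ C5 a d -> ~~ C5 b d -> c == d.
Proof. by case_ord a; case_ord b; case_ord c; case_ord d. Qed.

(** The colours in cyclic order, starting anywhere and running in either
    direction: arguments below are made once, for one labelling, and transferred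
    by [pentagon_rev]. *)
Definition pentagon a b c d e :=
  [&& C5 a b, C5 b c, C5 c d, C5 d e, C5 e a & uniq [:: a; b; c; d; e]].

Lemma pentagon_at a : exists b c d e, pentagon a b c d e.
Proof.
pose o k : 'I_5 := Ordinal (ltn_pmod k (isT : 0 < 5)).
exists (o a.+1), (o a.+2), (o a.+3), (o a.+4).
by case: a => -[|[|[|[|[|a]]]]] //.
Qed.

Lemma pentagon_rev a b c d e : pentagon a b c d e -> pentagon a e d c b.
Proof.
case/and5P=> ab bc cd de /andP[ea us].
rewrite /pentagon (adj_sym C5 a) ea (adj_sym C5 e) de (adj_sym C5 d) cd.
rewrite (adj_sym C5 c) bc (adj_sym C5 b) ab /=.
by move: us; rewrite /= !inE !(eq_sym a) !(eq_sym b) !(eq_sym c) !(eq_sym d);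
  do ![case: eqP => //].
Qed.

Lemma pentagonE a b c d e : pentagon a b c d e ->
  [/\ C5 a b, C5 a e, C5 c d, C5 d e &
   [/\ ~~ C5 a c, ~~ C5 a d, ~~ C5 c e, a != d & b != e]].
Proof.
case/and5P=> ab bc cd de /andP[ea].
rewrite /= !inE !negb_or => /and4P[/and4P[_ _ ad _] /and3P[_ _ be] _ _].
have ae : C5 a e by rewrite adj_sym.
split=> //; split=> //; first exact: C5_triangle_free ab bc.
- by apply: (C5_triangle_free ae); rewrite adj_sym.
- exact: C5_triangle_free cd de.
Qed.

(** * Triangle-free and fork-free graphs *)

Definition triangle_free (T : finType) (G : sgraph T) :=
  forall x y z, G x y -> G y z -> ~~ G x z.

Lemma free_K3_triangle_free (T : finType) (G : sgraph T) :
  free K3 G -> triangle_free G.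
Proof.
move=> noK3 x y z xy yz; apply/negP=> xz; apply: noK3.
exists (fun i : 'I_3 => nth x [:: x; y; z] i).
  have neq u v : G u v -> u != v.
    by move=> uv; apply: contraTneq uv => ->; rewrite adj_irr.
  have u3 : uniq [:: x; y; z] by rewrite /= !inE !negb_or !neq.
  by move=> i j /eqP; rewrite nth_uniq // => /eqP/val_inj.
case=> -[|[|[|i]]] //= ? [] [|[|[|j]]] //= ?; rewrite ?adj_irr //;
  by rewrite ?xy ?yz ?xz // adj_sym ?xy ?yz ?xz.
Qed.

Lemma triangle_free_free_K3 (T : finType) (G : sgraph T) :
  triangle_free G -> free K3 G.
Proof.
move=> tf [f _ fE].
pose o k := Ordinal (ltn_pmod k (isT : 0 < 3)).
have := tf (f (o 0)) (f (o 1)) (f (o 2)).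
by rewrite !fE; move/(_ isT isT).
Qed.

Lemma free_delv (S T : finType) (F : sgraph S) (G : sgraph T) (X : {set T}) :
  free F G -> free F (delv G X).
Proof.
move=> noF [f f_inj fE]; apply: noF; exists (fun x => val (f x)) => //.
by move=> x y /val_inj/f_inj.
Qed.

(** The form in which the exclusion of S_{2,1,1} is used: c is the centre of a
    would-be fork with long leg c, p, q and short legs r and s.  In a
    triangle-free graph, an edge from q to r or s is the only way in which these
    vertices can fail to induce the fork. *)
Definition leg_attached (T : finType) (G : sgraph T) :=
  forall c p q r s, G c p -> G p q -> G c r -> G c s -> r != s ->
  G q r || G q s.

(** All other additional edges would create triangles.  Apart from r and s, the
    vertices are distinct for free: a coincidence would again give one of the
    excluded adjacencies. *)
Lemma fork_free_leg_attached (T : finType) (G : sgraph T) :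
  free S211 G -> triangle_free G -> leg_attached G.
Proof.
move=> noF tf c p q r s cp pq cr cs rs; apply/negPn/negP=> /norP[qr qs].
have pr : ~~ G p r by apply: (tf p c r); rewrite // adj_sym.
have ps : ~~ G p s by apply: (tf p c s); rewrite // adj_sym.
have nrs : ~~ G r s by apply: (tf r c s); rewrite // adj_sym.
have cq : ~~ G c q := tf _ _ _ cp pq.
have u5 : uniq [:: c; p; q; r; s].
  have neq u v : G u v -> u != v.
    by move=> uv; apply: contraTneq uv => ->; rewrite adj_irr.
  have sep w u v : G w u -> ~~ G w v -> u != v.
    by move=> wu; apply: contraNneq => <-.
  rewrite /= !inE !negb_or rs (neq c p) // (neq c r) // (neq c s) //.
  rewrite (neq p q) // (sep r c q) 1?adj_sym // 1?(adj_sym G r) //=.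
  rewrite (sep q p r) // 1?adj_sym // (sep q p s) // 1?adj_sym //.
  by rewrite (sep p q r) // (sep p q s).
apply: noF; exists (fun i : 'I_5 => nth c [:: c; p; q; r; s] i).
  by move=> i j /eqP; rewrite nth_uniq // => /eqP/val_inj.
have F u v : ~~ G u v -> (G u v = false) * (G v u = false).
  by move=> /negbTE uv; rewrite (adj_sym G v) uv.
have E u v : G u v -> (G u v = true) * (G v u = true).
  by move=> uv; rewrite (adj_sym G v) uv.
move=> [] [|[|[|[|[|i]]]]] //= ? [] [|[|[|[|[|j]]]]] //= ?;
  rewrite ?adj_irr ?(F _ _ cq) ?(F _ _ pr) ?(F _ _ ps) ?(F _ _ qr)
    ?(F _ _ qs) ?(F _ _ nrs) ?(E _ _ cp) ?(E _ _ pq) ?(E _ _ cr) ?(E _ _ cs) //.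
Qed.

(** * Extending partial colourings by the 5-cycle *)

Section Extension.
Variables (T : finType) (H : sgraph T).
Hypotheses (tf : triangle_free H) (leg : leg_attached H).

Implicit Types (g : T -> option 'I_5) (x y z u v w : T) (a b c d e : 'I_5).

(** The colours a and b must be joined by a walk of length k in the 5-cycle
    whenever u and v are joined by one in [H], for k = 1, 2, 3.  Quantifying
    over walks instead of induced paths costs nothing, since the condition is
    necessary for all of them, and avoids distinctness assumptions. *)
Definition consistent g := forall u v a b, g u = Some a -> g v = Some b ->
  [/\ H u v -> C5 a b,
      forall x, H u x -> H x v -> ~~ C5 a b &
      forall x y, H u x -> H x y -> H y v -> a != b].

(** The ways in which giving x the colour c would destroy consistency. *)
Definition blocked g x c :=
  [|| [exists w, exists e, [&& H x w, g w == Some e & ~~ C5 c e]],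
      [exists y, exists w, exists e,
         [&& H x y, H y w, g w == Some e & C5 c e]] |
      [exists y, exists z, exists w,
         [&& H x y, H y z, H z w & g w == Some c]]].

Lemma blockedP g x c : reflect
  [\/ exists w e, [/\ H x w, g w = Some e & ~~ C5 c e],
      exists y w e, [/\ H x y, H y w, g w = Some e & C5 c e] |
      exists y z w, [/\ H x y, H y z, H z w & g w = Some c]]
  (blocked g x c).
Proof.
apply: (iffP or3P) => -[].
- case/existsP=> w /existsP[e /and3P[xw /eqP gw ce]].
  by constructor 1; exists w, e.
- case/existsP=> y /existsP[w /existsP[e /and4P[xy yw /eqP gw ce]]].
  by constructor 2; exists y, w, e.
- case/existsP=> y /existsP[z /existsP[w /and4P[xy yz zw /eqP gw]]].
  by constructor 3; exists y, z, w.
- case=> w [e [xw gw ce]]; constructor 1; apply/existsP; exists w.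
  by apply/existsP; exists e; rewrite xw gw eqxx.
- case=> y [w [e [xy yw gw ce]]]; constructor 2; apply/existsP; exists y.
  by apply/existsP; exists w; apply/existsP; exists e; rewrite xy yw gw eqxx.
- case=> y [z [w [xy yz zw gw]]]; constructor 3; apply/existsP; exists y.
  by apply/existsP; exists z; apply/existsP; exists w; rewrite xy yz zw gw eqxx.
Qed.

Definition assign g x c : T -> option 'I_5 :=
  fun v => if v == x then Some c else g v.

Lemma assign_consistent g x c :
  consistent g -> ~~ blocked g x c -> consistent (assign g x c).
Proof.
move=> gP nb.
have far w e : g w = Some e ->
    [/\ H x w -> C5 c e, forall y, H x y -> H y w -> ~~ C5 c e &
        forall y z, H x y -> H y z -> H z w -> c != e].
  move=> gw; split.
  - move=> xw; apply: contraNT nb => ce; apply/blockedP.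
    by constructor 1; exists w, e.
  - move=> y xy yw; apply: contra nb => ce; apply/blockedP.
    by constructor 2; exists y, w, e.
  - move=> y z xy yz zw; apply: contra nb => /eqP ce; apply/blockedP.
    by constructor 3; exists y, z, w; rewrite gw ce.
move=> u v a b; rewrite /assign.
case: (eqVneq u x) => [->|_]; case: (eqVneq v x) => [->|_].
- move=> [<-] [<-]; split; rewrite ?adj_irr // => y z xy yz zx.
  by have := tf xy yz; rewrite adj_sym zx.
- by move=> [<-]; apply: far.
- move=> gu [<-]; have [f1 f2 f3] := far u a gu; split.
  + by rewrite adj_sym (adj_sym C5); apply: f1.
  + move=> y uy yx; rewrite (adj_sym C5); apply: (f2 y); by rewrite adj_sym.
  + move=> y z uy yz zx; rewrite eq_sym; apply: (f3 z y); by rewrite adj_sym.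
- exact: gP.
Qed.

Section Step.
Variables (g : T -> option 'I_5) (x u0 : T) (a : 'I_5).
Hypothesis gP : consistent g.
Hypotheses (xu0 : H x u0) (gu0 : g u0 = Some a).

Let L1 u v b c : g u = Some b -> g v = Some c -> H u v -> C5 b c.
Proof. by move=> gu gv; case: (gP gu gv). Qed.

Let L2 u y v b c : g u = Some b -> g v = Some c -> H u y -> H y v -> ~~ C5 b c.
Proof. by move=> gu gv; case: (gP gu gv) => _ + _; apply. Qed.

Let L3 u y z v b c : g u = Some b -> g v = Some c ->
  H u y -> H y z -> H z v -> b != c.
Proof. by move=> gu gv; case: (gP gu gv) => _ _; apply. Qed.

Let u0x : H u0 x. Proof. by rewrite adj_sym. Qed.

(** What can exclude a neighbour b of the colour a at x, when the 5-cycle reads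
    a, b, c, d, e: since x already has a neighbour u0 of colour a, the colours
    that remain for the conflicting vertex are determined by its distance. *)
Definition obstruction b c d :=
  [\/ exists2 w, H x w & g w = Some d,
      exists y w, [/\ H x y, H y w & g w = Some c] |
      exists y z w, [/\ H x y, H y z, H z w & g w = Some b]].

Lemma blocked_obstruction b c d e : pentagon a b c d e ->
  blocked g x b -> obstruction b c d.
Proof.
case/and5P=> ab bc cd de /andP[ea uq] /blockedP[].
- case=> w [f [xw gw bf]]; constructor 1; exists w => //.
  rewrite gw; congr Some; apply/eqP; apply: (C5_nonneighbours_of_edge ab) => //.
  + exact: L2 gu0 gw u0x xw.
  + by apply: (C5_triangle_free (b := e)) => //; rewrite adj_sym.
  + by apply: (C5_triangle_free (b := c)).
- case=> y [w [f [xy yw gw bf]]]; constructor 2; exists y, w; split=> //.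
  have ba : C5 b a by rewrite adj_sym.
  have ac : a != c.
    by move: uq; rewrite /= !inE !negb_or; case: (a == c); rewrite ?andbF.
  case/orP: (C5_degree_le2 ac ba bc bf) => /eqP ef; last by rewrite gw ef.
  by have := L3 gu0 gw u0x xy yw; rewrite ef eqxx.
- by constructor 3.
Qed.

Let sym u v : H u v -> H v u. Proof. by rewrite adj_sym. Qed.

(** A walk of length 3 to a vertex of colour e cannot coexist with any
    obstruction to b.  For an obstruction at distance 1, attaching z to a
    coloured neighbour of x gives a forbidden walk of length 2.  Otherwise two
    walks leave x, and attaching the leg of the first one lets both pass through
    y; attaching one more leg then produces a walk of length at most 2 between
    vertices whose colours forbid it. *)
Lemma obstruction_near_far b c d e y z w : pentagon a b c d e ->
  obstruction b c d -> H x y -> H y z -> H z w -> g w = Some e -> False.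
Proof.
move=> /pentagonE[ab ae cd de [ac ad ce nad nbe]] obs xy yz zw gw.
have nu0z : ~~ H u0 z.
  by apply/negP=> u0z; have := L2 gu0 gw u0z zw; rewrite ae.
have nu0y : u0 != y by apply: contraNneq nu0z => ->.
case: obs => [[w1 xw1 gw1]|[y1 [w1 [xy1 yw1 gw1]]]|].
- have nuw : u0 != w1.
    by apply: contraNneq nad => uw; move: gu0; rewrite uw gw1 => -[->].
  case/orP: (leg xy yz xu0 xw1 nuw) => [/sym|/sym w1z]; first exact/negP.
  by have := L2 gw1 gw w1z zw; rewrite de.
- have nu0w1 : ~~ H u0 w1.
    by apply/negP=> u0w1; have := L1 gu0 gw1 u0w1; rewrite (negbTE ac).
  case/orP: (leg xy1 yw1 xu0 xy nu0y) => [/sym|/sym yw1']; first exact/negP.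
  have nw1z : w1 != z.
    by apply: contraNneq ce => w1z; apply: (L1 gw1 gw); rewrite w1z.
  by case/orP: (leg (sym xy) xu0 yw1' yz nw1z); apply/negP.
- case=> y1 [z1 [w1 [xy1 yz1 zw1 gw1]]]; have nu0z1 : ~~ H u0 z1.
    by apply/negP=> u0z1; have := L2 gu0 gw1 u0z1 zw1; rewrite ab.
  case/orP: (leg xy1 yz1 xu0 xy nu0y) => [/sym|/sym yz1']; first exact/negP.
  have [z1z|nz1z] := eqVneq z1 z; last first.
    by case/orP: (leg (sym xy) xu0 yz1' yz nz1z); apply/negP.
  rewrite {}z1z in zw1.
  have nw : w1 != w.
    by apply: contraNneq nbe => ww; move: gw; rewrite -ww gw1 => -[->].
  case/orP: (leg (sym yz) (sym xy) zw1 zw nw) => [xw1|xw].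
    by have := L2 gu0 gw1 u0x xw1; rewrite ab.
  by have := L2 gu0 gw u0x xw; rewrite ae.
Qed.

(** The case of an obstruction at distance 3 is the previous lemma, on either
    side by reversal of the cycle; the remaining four cases have both
    obstructions at distance at most 2. *)
Lemma obstructions_clash b c d e : pentagon a b c d e ->
  obstruction b c d -> obstruction e d c -> False.
Proof.
move=> pent o1 o2.
case: (o2) => [[w2 xw2 gw2]|[y2 [w2 [xy2 yw2 gw2]]]|[y [z [w [xy yz zw gw]]]]];
  last exact: (obstruction_near_far pent o1 xy yz zw gw);
case: o1 => [[w1 xw1 gw1]|[y1 [w1 [xy1 yw1 gw1]]]|[y [z [w [xy yz zw gw]]]]];
  try exact: (obstruction_near_far (pentagon_rev pent) o2 xy yz zw gw);
case/pentagonE: pent => ab ae cd de [ac ad ce nad nbe].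
- by have := L2 gw2 gw1 (sym xw2) xw1; rewrite cd.
- by have := L3 gw2 gw1 (sym xw2) xy1 yw1; rewrite eqxx.
- by have := L3 gw1 gw2 (sym xw1) xy2 yw2; rewrite eqxx.
- have nuy : u0 != y2.
    by apply: contraNneq ad => uy; apply: (L1 gu0 gw2); rewrite uy.
  case/orP: (leg xy1 yw1 xu0 xy2 nuy) => [/sym u0w1|w1y2].
    by have := L1 gu0 gw1 u0w1; rewrite (negbTE ac).
  by have := L2 gw1 gw2 w1y2 yw2; rewrite cd.
Qed.

Lemma unblocked_colour : exists c, ~~ blocked g x c.
Proof.
have [b [c [d [e pent]]]] := pentagon_at a.
have [bb|] := boolP (blocked g x b); last by exists b.
have [be|] := boolP (blocked g x e); last by exists e.
case: (obstructions_clash pent (blocked_obstruction pent bb)).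
exact: blocked_obstruction (pentagon_rev pent) be.
Qed.

End Step.

(** The vertex to be coloured must be chosen well: [unblocked_colour] needs a
    coloured neighbour.  The given x itself serves only if no uncoloured vertex
    has one. *)
Lemma consistent_extend_one g x : consistent g -> g x = None ->
  exists y c, g y = None /\ consistent (assign g y c).
Proof.
move=> gP gx.
have [/existsP[y /existsP[u /and3P[/eqP gy yu gu]]]|none] :=
    boolP [exists y, exists u, [&& g y == None, H y u & g u != None]].
  case gua: (g u) gu => [a|] // _.
  have [c nb] := unblocked_colour gP yu gua.
  by exists y, c; split=> //; apply: assign_consistent.
(* No walk from an uncoloured vertex reaches a coloured one. *)
exists x, ord0; split=> //; apply: assign_consistent => //.
have unc y z : g y = None -> H y z -> g z = None.
  move=> gy yz; apply/eqP; apply: contraNT none => gz.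
  by apply/existsP; exists y; apply/existsP; exists z; rewrite gy yz.
apply/blockedP=> -[].
- by case=> w [e [/(unc _ _ gx)->]].
- by case=> y [w [e [/(unc _ _ gx)/unc + yw] ]] => /(_ _ yw) ->.
- case=> y [z [w [/(unc _ _ gx)/unc + yz zw]]] => /(_ _ yz)/unc/(_ zw).
  by move=> ->.
Qed.

Lemma consistent_extends g : consistent g ->
  exists2 h : T -> 'I_5, homomorphism H C5 h &
    forall x c, g x = Some c -> h x = c.
Proof.
have [k] := ubnP #|[set x | g x == None]|.
elim: k g => // k IH g lek gP.
have [/existsP[x /eqP gx]|total] := boolP [exists x, g x == None].
  have [y [c [gy g'P]]] := consistent_extend_one gP gx.
  have ltk : #|[set v | assign g y c v == None]| < k.
    rewrite -ltnS; apply: leq_trans lek; rewrite ltnS.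
    apply: proper_card; apply/properP; split.
      by apply/subsetP=> v; rewrite !inE /assign; case: (v == y).
    by exists y; rewrite !inE ?gy // /assign eqxx.
  have [h h_hom hE] := IH _ ltk g'P; exists h => // v e gv; apply: hE.
  by rewrite /assign; case: (eqVneq v y) gv => [->|_ ->] //; rewrite gy.
have gT x : exists c, g x = Some c.
  case gx: (g x) => [c|]; first by exists c.
  by case/existsP: total; exists x; rewrite gx.
exists (fun x => odflt ord0 (g x)) => [x y xy|x c ->] //.
have [[c gx] [d gy]] := (gT x, gT y); rewrite gx gy /=.
by case: (gP x y c d gx gy) => /(_ xy).
Qed.

End Extension.

(** * Colourings by the 5-wheel and sets hitting all triangles *)

Notation hub := (ord0 : 'I_6).
Definition rim (k : 'I_5) : 'I_6 := lift ord0 k.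

Lemma W5_rim k l : W5 (rim k) (rim l) = C5 k l.
Proof. by case: k l => -[|[|[|[|[|k]]]]] // ? [] -[|[|[|[|[|l]]]]] // ?. Qed.

Lemma W5_hub_rim k : W5 hub (rim k).
Proof. by case: k => -[|[|[|[|[|k]]]]]. Qed.

Lemma hub_or_rim (c : 'I_6) : c = hub \/ exists k, c = rim k.
Proof. by case: (unliftP hub c) => [k ->|->]; [right; exists k | left]. Qed.

Lemma hub_neq_rim k : (hub == rim k) = false.
Proof. exact: negbTE (neq_lift ord0 k). Qed.

Section Reduction.
Variables (T : finType) (G : sgraph T) (pre : T -> option 'I_6).

Definition sees x k := [exists u, G x u && (pre u == Some (rim k))].

(** A vertex that sees adjacent rim colours k and l must be mapped to a common
    neighbour of them in the wheel, which can only be the hub. If x has colour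
    k and sees a non-adjacent l, no extension exists; x then also satisfies
    [on_rim], so that the two requirements on x contradict each other. *)
Definition forced_hub x :=
  (pre x == Some hub) ||
  [exists k, exists l, if C5 k l then sees x k && sees x l
                       else (pre x == Some (rim k)) && sees x l].

Definition on_rim x := [exists k, pre x == Some (rim k)].

(** If adjacent x and y both had rim colours, then these would form a triangle
    of the 5-cycle together with a rim colour that both vertices see. *)
Definition see_common x y := [exists k, sees x k && sees y k].

Definition hit_edges : {set {set T}} :=
  [set [set p.1; p.2] | p : T * T & G p.1 p.2 && see_common p.1 p.2].

Lemma hit_edges_sub : hit_edges \subset edges G.
Proof.
apply/subsetP=> e /imsetP[p]; rewrite inE => /andP[Gp _] ->.
by apply/imsetP; exists p; rewrite ?inE.
Qed.

(** The encoding of an instance tests membership of unordered pairs, the program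
    evaluates the condition on ordered ones; they agree by symmetry. *)
Lemma mem_hit_edges x y : ([set x; y] \in hit_edges) = G x y && see_common x y.
Proof.
apply/imsetP/idP => [[[u v]]|xy]; last by exists (x, y); rewrite ?inE.
rewrite inE /= => /andP[uv cuv] exy.
have neq a b : G a b -> a != b.
  by move=> ab; apply: contraTneq ab => ->; rewrite adj_irr.
have [xuv yuv] : x \in [set u; v] /\ y \in [set u; v].
  by rewrite -exy !inE !eqxx orbT.
have [uxy vxy] : u \in [set x; y] /\ v \in [set x; y].
  by rewrite exy !inE !eqxx orbT.
move: xuv yuv uxy vxy; rewrite !inE.
have cvu : see_common v u.
  by case/existsP: cuv => k /andP[uk vk]; apply/existsP; exists k; rewrite vk.
case/orP=> /eqP->; case/orP=> /eqP->;
  rewrite ?uv ?cuv ?(adj_sym G v u) ?uv ?cvu //;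
  by move=> + +; rewrite !orbb 1?(eq_sym v) (negbTE (neq _ _ uv)).
Qed.

Definition extends_to_W5 :=
  exists2 psi : T -> 'I_6, homomorphism G W5 psi &
    forall v c, pre v = Some c -> psi v = c.

Definition hub_class (X : {set T}) :=
  [/\ independent G X, [set x | forced_hub x] \subset X,
      forall e, e \in hit_edges -> e :&: X != set0,
      [set x | on_rim x] :&: X = set0 & free K3 (delv G X)].

Lemma seesP x k : reflect (exists2 u, G x u & pre u = Some (rim k)) (sees x k).
Proof.
apply: (iffP existsP) => [[u /andP[xu /eqP]]|[u xu pu]]; first by exists u.
by exists u; rewrite xu pu eqxx.
Qed.

(** The colour class of the hub works: a vertex outside it has a rim colour
    adjacent to all rim colours that it sees, and the 5-cycle is
    triangle-free. *)
Lemma extends_hub_class : extends_to_W5 -> exists X, hub_class X.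
Proof.
case=> psi hom ext; exists [set x | psi x == hub].
have sees_rim x k :
    sees x k -> psi x = hub \/ exists2 j, psi x = rim j & C5 j k.
  case/seesP=> u xu /ext pu.
  case: (hub_or_rim (psi x)) => [|[j pj]]; first by left.
  by right; exists j => //; have := hom _ _ xu; rewrite pj pu W5_rim.
split.
- move=> x y; rewrite !inE => /eqP px /eqP py.
  by apply/negP=> /hom; rewrite px py adj_irr.
- apply/subsetP=> x; rewrite !inE => /orP[/eqP/ext->//|].
  case/existsP=> k /existsP[l].
  case: ifP => [kl /andP[xk xl]|kl /andP[/eqP/ext px xl]].
    case: (sees_rim _ _ xk) => [->//|[i pi ik]].
    case: (sees_rim _ _ xl) => [->//|[j pj jl]].
    have ij : i = j by apply: (@lift_inj _ ord0); rewrite -[LHS]pi -[RHS]pj.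
    by have := C5_triangle_free ik kl; rewrite ij jl.
  case: (sees_rim _ _ xl) => [->//|[i pi il]].
  have ik : i = k by apply: (@lift_inj _ ord0); rewrite -[LHS]pi -[RHS]px.
  by rewrite ik kl in il.
- move=> e /imsetP[[x y]]; rewrite inE /= => /andP[xy].
  case/existsP=> k /andP[xk yk] ->; apply/set0Pn.
  case: (sees_rim _ _ xk) => [px|[i pi ik]].
    by exists x; rewrite !inE px !eqxx.
  case: (sees_rim _ _ yk) => [py|[j pj jk]].
    by exists y; rewrite !inE py !eqxx orbT.
  have := hom _ _ xy; rewrite pi pj W5_rim => ij.
  by have := C5_triangle_free ij jk; rewrite ik.
- apply/eqP; rewrite -subset0; apply/subsetP=> x; rewrite !inE.
  by case/andP=> /existsP[k /eqP/ext->]; rewrite eq_sym hub_neq_rim.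
- apply: triangle_free_free_K3; move=> [x xX] [y yX] [z zX] xy yz.
  have {}xy : G x y := xy; have {}yz : G y z := yz.
  apply/negP=> xz; have {}xz : G x z := xz.
  move: xX yX zX; rewrite !inE.
  case: (hub_or_rim (psi x)) => [->//|[i pi] _].
  case: (hub_or_rim (psi y)) => [->//|[j pj] _].
  case: (hub_or_rim (psi z)) => [->//|[k pk] _].
  have := (hom _ _ xy, hom _ _ yz, hom _ _ xz); rewrite pi pj pk !W5_rim.
  by case=> -[ij jk] ik; have := C5_triangle_free ij jk; rewrite ik.
Qed.

(** The three requirements on X ensure that the prescribed rim colours are
    consistent on [G - X]. *)
Lemma hub_class_extends :
  free S211 G -> (exists X, hub_class X) -> extends_to_W5.
Proof.
move=> noF [X [indX inX hitX outX /free_K3_triangle_free tf]].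
have leg := fork_free_leg_attached (free_delv (X := X) noF) tf.
have hubX x : pre x = Some hub -> x \in X.
  by move=> px; apply: (subsetP inX); rewrite !inE /forced_hub px eqxx.
have rimX x k : pre x = Some (rim k) -> x \notin X.
  move=> px; apply/negP=> xX; have : x \in set0; last by rewrite inE.
  rewrite -outX !inE xX andbT; apply/existsP; exists k; exact/eqP.
pose g (x : {x | x \notin X}) := obind (unlift hub) (pre (val x)).
have gP x k : g x = Some k -> pre (val x) = Some (rim k).
  rewrite /g; case: (pre _) => //= c; case: unliftP => // j -> [->] //.
have gcons : consistent (delv G X) g.
  move=> [u uX] [v vX] a b gu gv.
  have /= pu := gP _ _ gu; have /= pv := gP _ _ gv; clear gu gv; split.
  - move=> uv; have {}uv : G u v := uv.
    apply: contraNT uX => nab; apply: (subsetP inX).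
    rewrite inE /forced_hub; apply/orP; right; apply/existsP; exists a.
    apply/existsP; exists b; have /negbTE -> : ~~ C5 a b := nab.
    rewrite pu eqxx; apply/seesP.
    by exists v.
  - move=> [x xX] ux xv; have {}ux : G u x := ux; have {}xv : G x v := xv.
    apply: contra xX => ab; apply: (subsetP inX).
    rewrite inE /forced_hub; apply/orP; right; apply/existsP; exists a.
    apply/existsP; exists b; have -> : C5 a b := ab.
    apply/andP; split; apply/seesP.
      by exists u; rewrite // adj_sym.
    by exists v.
  - move=> [x xX] [y yX] ux xy yv; have {}ux : G u x := ux.
    have {}xy : G x y := xy; have {}yv : G y v := yv; apply/eqP=> ab.
    have : [set x; y] \in hit_edges.
      rewrite mem_hit_edges xy; apply/existsP; exists a.
      apply/andP; split; apply/seesP; first by exists u; rewrite // adj_sym.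
      by exists v; rewrite // ab.
    case/hitX/set0Pn=> z; rewrite !inE => /andP[/orP[]/eqP->].
      by rewrite (negbTE xX).
    by rewrite (negbTE yX).
have [h h_hom hE] := consistent_extends tf leg gcons.
pose psi x := if insub x is Some y then rim (h y) else hub.
exists psi => [x y xy|x c px]; rewrite /psi.
  case: insubP => [x' xX ex|]; case: insubP => [y' yX ey|].
  - by rewrite W5_rim; apply: h_hom; rewrite /= /delv_adj /= ex ey.
  - by rewrite adj_sym W5_hub_rim.
  - by rewrite W5_hub_rim.
  - by rewrite !negbK => yX xX; have := indX _ _ xX yX; rewrite xy.
case: (hub_or_rim c) px => [->|[k ->]] px; first by rewrite insubF // hubX.
rewrite insubT ?(rimX _ _ px) // => xX; congr rim; apply: hE.
by rewrite /g /= px /= liftK.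
Qed.

End Reduction.

(** * Total correctness of programs with time bounds *)

Definition assertion := memory -> seq nat -> Prop.

(** Total correctness: executions are exhibited, so that termination, running
    time and result are obtained together. *)
Definition hoare (P : assertion) (c : cmd) (t : nat) (Q : assertion) :=
  forall m o, P m o ->
    exists s m' o', [/\ exec c m o s m' o', s <= t & Q m' o'].

Lemma hoare_put P a e1 e2 (Q : assertion) :
  (forall m o, P m o -> Q (upd m a (eval m e1) (eval m e2)) o) ->
  hoare P (Put a e1 e2) 1 Q.
Proof.
by move=> PQ m o Pmo; do 3 eexists; split; [exact: ExecPut | | exact: PQ].
Qed.

Lemma hoare_emit P e (Q : assertion) :
  (forall m o, P m o -> Q m (rcons o (eval m e))) -> hoare P (Emit e) 1 Q.
Proof.
by move=> PQ m o Pmo; do 3 eexists; split; [exact: ExecEmit | | exact: PQ].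
Qed.

Lemma hoare_seq P Q R c1 c2 t1 t2 :
  hoare P c1 t1 Q -> hoare Q c2 t2 R -> hoare P (Seq c1 c2) (t1 + t2) R.
Proof.
move=> H1 H2 m o /H1[s1 [m1 [o1 [X1 le1 /H2[s2 [m2 [o2 [X2 le2 R2]]]]]]]].
by do 3 eexists; split; [exact: ExecSeq X1 X2 | exact: leq_add |].
Qed.

Definition reg a := Get a (Const 0).

Definition incr r := Put r (Const 0) (Add (reg r) (Const 1)).

Definition For r e c :=
  Seq (Put r (Const 0) (Const 0)) (While (Defs.Sub e (reg r)) (Seq c (incr r))).

(** The invariant is about the data only.  It must not depend on the loop
    counter, stored in cell 0 of array r, which the body has to preserve; that
    counter is passed separately. *)
Lemma hoare_for (P : nat -> assertion) r e c n t :
  (forall i m o v, P i m o -> P i (upd m r 0 v) o) ->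
  (forall i m o, P i m o -> eval m e = n) ->
  (forall i, i < n -> hoare (fun m o => P i m o /\ m r 0 = i) c t
                            (fun m o => P i.+1 m o /\ m r 0 = i)) ->
  hoare (P 0) (For r e c) (n * t.+2).+2 (P n).
Proof.
move=> Pr Pe Pc.
apply: (@hoare_seq _ (fun m o => P 0 m o /\ m r 0 = 0) _ _ _ 1 (n * t.+2).+1).
  by apply: hoare_put => m o P0; split; [exact: Pr | rewrite /upd !eqxx].
have loop k : k <= n -> hoare (fun m o => P (n - k) m o /\ m r 0 = n - k)
    (While (Defs.Sub e (reg r)) (Seq c (incr r))) (k * t.+2).+1 (P n);
  last by have := loop n (leqnn n); rewrite subnn.
elim: k => [|k IH] kn m o [Pm mr].
  exists 1, m, o; split=> //; last by rewrite subn0 in Pm.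
  by apply: ExecWhileFalse; rewrite /= (Pe _ _ _ Pm) mr subn0 subnn.
have ltn : n - k.+1 < n by rewrite ltn_subrL (leq_trans _ kn).
have Sk : (n - k.+1).+1 = n - k by rewrite subnSK.
have [s1 [m1 [o1 [X1 le1 [P1 mr1]]]]] := Pc _ ltn m o (conj Pm mr).
pose m2 := upd m1 r 0 (m1 r 0 + 1).
have [|s2 [m3 [o3 [X2 le2 P3]]]] := IH (ltnW kn) m2 o1.
  by rewrite -Sk; split; [exact: Pr | rewrite /m2 /upd !eqxx mr1 addn1].
do 3 eexists; split; [apply: ExecWhileTrue X2 | | exact: P3].
- by rewrite /= (Pe _ _ _ Pm) mr subKn.
- by apply: ExecSeq X1 (ExecPut _ _ _ _ _).
- by have := leq_add le1 le2; rewrite mulSn addn1 addnS !addSn !ltnS.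
Qed.

(** Boolean connectives on expressions, any nonzero value being true.  [Not]
    returns 0 or 1, hence [Truth] normalises. *)
Definition holds m e := eval m e != 0.
Definition Not e := Defs.Sub (Const 1) e.
Definition Truth e := Not (Not e).
Definition And e1 e2 := Not (Add (Not e1) (Not e2)).
Definition Eq e1 e2 := Not (Add (Defs.Sub e1 e2) (Defs.Sub e2 e1)).
Definition Any := foldr Add (Const 0).

Lemma holds_Not m e : holds m (Not e) = ~~ holds m e.
Proof. by rewrite /holds /=; case: (eval m e). Qed.

Lemma eval_Truth m e : eval m (Truth e) = holds m e.
Proof. by rewrite /holds /=; case: (eval m e). Qed.

Lemma holds_Add m e1 e2 : holds m (Add e1 e2) = holds m e1 || holds m e2.
Proof. by rewrite /holds /= addn_eq0 negb_and. Qed.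

Lemma holds_And m e1 e2 : holds m (And e1 e2) = holds m e1 && holds m e2.
Proof. by rewrite holds_Not holds_Add !holds_Not negb_or !negbK. Qed.

Lemma holds_Eq m e1 e2 : holds m (Eq e1 e2) = (eval m e1 == eval m e2).
Proof. by rewrite holds_Not holds_Add negb_or /holds !negbK [RHS]eqn_leq. Qed.

Lemma holds_Any m es : holds m (Any es) = has (holds m) es.
Proof. by elim: es => //= e es IH; rewrite holds_Add IH. Qed.

(** Multiplication by a constant has to be unfolded into additions. *)
Definition times k e := iter k (Add e) (Const 0).

Lemma eval_times m k e : eval m (times k e) = k * eval m e.
Proof. by elim: k => //= k ->; rewrite mulSn. Qed.

(** * A program computing the reduction *)

(** Array 0 holds the input: the order n, the n rows of the adjacency matrix
    and the colour codes.  Array 1 receives the multiples of n, which locate the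
    rows as well as (at index n) the colour codes.  Array 2 counts, in blocks of
    seven cells, the neighbours of a vertex of each colour code 0, ..., 6.
    Arrays 3 and 4 hold the loop counters. *)
Definition order := Get 0 (Const 0).
Definition row_start e := Get 1 e.
Definition edge_bit := Get 0 (Add (Const 1) (Add (row_start (reg 3)) (reg 4))).
Definition colour_of e := Get 0 (Add (Const 1) (Add (row_start order) e)).
Definition slot v k := Add (times 7 v) k.
Definition seen v (k : nat) := Get 2 (slot v (Const k)).

Definition fill_row_starts :=
  For 3 order (Put 1 (Add (reg 3) (Const 1)) (Add (row_start (reg 3)) order)).

Definition seen_slot := slot (reg 3) (colour_of (reg 4)).

Definition fill_seen :=
  For 3 order (For 4 order (Put 2 seen_slot (Add (Get 2 seen_slot) edge_bit))).

Definition emit_vertices e := For 3 order (Emit (Truth e)).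
Definition emit_pairs e := For 3 order (For 4 order (Emit (Truth e))).

Section Run.
Variables (n : nat) (A : nat -> nat -> bool) (K : nat -> nat) (w : seq nat).
Hypothesis w_order : nth 0 w 0 = n.
Hypothesis w_adj : forall x y, x < n -> y < n -> nth 0 w (x * n + y).+1 = A x y.
Hypothesis w_col : forall v, v < n -> nth 0 w (n * n + v).+1 = K v.
Hypothesis K_lt : forall v, v < n -> K v < 7.

Definition rows_ok i m := m 0 = nth 0 w /\ forall j, j <= i -> m 1 j = j * n.

Definition count_seen y v k := \sum_(0 <= u < y | K u == k) A v u.

(** The count for v when the outer loop has reached x and the inner loop y. *)
Definition seen_upto x y v :=
  count_seen (if v < x then n else if v == x then y else 0) v.

Definition seen_ok x y m := forall v k, v < n -> k < 7 ->
  m 2 (7 * v + k) = seen_upto x y v k.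

Lemma fill_row_startsP :
  hoare (fun m o => m = load w /\ o = [::]) fill_row_starts (n * 3).+2
    (fun m o => [/\ rows_ok n m, seen_ok 0 0 m & o = [::]]).
Proof.
pose P i m o := [/\ rows_ok i m, m 2 =1 (fun=> 0) & o = [::] :> seq nat].
have : hoare (P 0) fill_row_starts (n * 3).+2 (P n).
  apply: hoare_for => // [i m o [[m0 _] _ _]|i ltin]; first by rewrite /= m0.
  apply: hoare_put => m o [[[m0 m1] m2 o0] mi]; split=> //; split=> //.
  split=> // j; rewrite leq_eqVlt /= /upd /= mi addn1.
  case: eqP => [-> _|_ /= ltji]; last exact: m1.
  by rewrite m0 w_order m1 // addnC mulSn.
move=> run m o [-> ->].
case: (run (load w) [::]) => [|t [m' [o' [X le [R m2 o0]]]]].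
  by split=> //; split=> // j; rewrite leqn0 => /eqP->.
exists t, m', o'; split=> //; split=> // v k _ _; rewrite m2 /seen_upto.
by rewrite ltn0 if_same /count_seen big_geq.
Qed.

Lemma rows_order m : rows_ok n m -> eval m order = n.
Proof. by case=> m0 _; rewrite /= m0. Qed.

Lemma eval_edge_bit m x y : rows_ok n m -> m 3 0 = x -> m 4 0 = y ->
  x < n -> y < n -> eval m edge_bit = A x y.
Proof.
by case=> m0 m1 mx my xn yn; rewrite /= mx my m1 ?(ltnW xn) // m0 add1n w_adj.
Qed.

Lemma eval_colour_of m e v : rows_ok n m -> eval m e = v -> v < n ->
  eval m (colour_of e) = K v.
Proof. by case=> m0 m1 ev vn; rewrite /= ev m0 w_order m1 // add1n w_col. Qed.

(** Colour codes are below 7, so the blocks of different vertices are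
    disjoint. *)
Lemma slot_inj v u k l : k < 7 -> l < 7 ->
  (7 * v + k == 7 * u + l) = (v == u) && (k == l).
Proof.
move=> k7 l7; apply/eqP/andP => [e|[/eqP-> /eqP->] //].
have := congr1 (divn^~ 7) e.
rewrite !(mulnC 7) !divnMDl // !divn_small // !addn0.
by move=> vu; move: e; rewrite vu => /addnI->.
Qed.

Lemma fill_seenP :
  hoare (fun m o => [/\ rows_ok n m, seen_ok 0 0 m & o = [::]])
    fill_seen (n * (n * 3).+4).+2
    (fun m o => [/\ rows_ok n m, seen_ok n 0 m & o = [::]]).
Proof.
pose P x m o := [/\ rows_ok n m, seen_ok x 0 m & o = [::] :> seq nat].
apply: (@hoare_for P) => // [i m o [R _ _]|x ltxn]; first exact: rows_order.
pose Q y m o :=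
  [/\ rows_ok n m, seen_ok x y m & o = [::] :> seq nat] /\ m 3 0 = x.
have : hoare (Q 0)
    (For 4 order (Put 2 seen_slot (Add (Get 2 seen_slot) edge_bit)))
    (n * 3).+2 (Q n).
  apply: (@hoare_for Q) => // [i m o [[R _ _]] _|y ltyn].
    exact: rows_order.
  apply: hoare_put => m o [[[R S o0] mx] my].
  have edge := eval_edge_bit R mx my ltxn ltyn.
  have col : eval m (colour_of (reg 4)) = K y by apply: eval_colour_of.
  have slotE : eval m seen_slot = 7 * x + K y.
    rewrite -col -[LHS]/(eval m (times 7 (reg 3)) + _).
    by rewrite eval_times /= mx.
  split; last exact: my.
  split; last exact: mx.
  split=> //.
  rewrite -[eval m (Add _ _)]/(m 2 (eval m seen_slot) + eval m edge_bit).
  rewrite slotE edge => v k ltvn k7; rewrite /upd /= slot_inj ?K_lt //.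
  rewrite S ?K_lt // /seen_upto /count_seen.
  case: (ltngtP v x) => [ltvx|ltxv|->] /=; rewrite ?S // /seen_upto ?ltvx //.
  - by rewrite ltnNge (ltnW ltxv) /= (gtn_eqF ltxv).
  - rewrite ltnn eqxx big_mkcond [in RHS]big_mkcond /= big_nat_recr //=.
    case: eqP => [->|]; first by rewrite eqxx.
    by rewrite eq_sym => /eqP/negbTE->; rewrite addn0 /count_seen big_mkcond.
move=> run m o [[R S o0] mx].
case: (run m o) => // t [m' [o' [X le [[R' S' o0'] mx']]]].
exists t, m', o'; split=> //; split=> //; split=> // v k ltvn k7.
rewrite S' // /seen_upto ltnS [if v == x.+1 then _ else _]if_same.
by case: (ltngtP v x).
Qed.

Definition ready m := rows_ok n m /\ forall v k, v < n -> k < 7 ->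
  (m 2 (7 * v + k) != 0) = has (fun u => A v u && (K u == k)) (iota 0 n).

Lemma seen_ok_ready m : rows_ok n m -> seen_ok n 0 m -> ready m.
Proof.
move=> R S; split=> // v k ltvn k7; rewrite S // /seen_upto ltvn /count_seen.
rewrite sum_nat_seq_neq0 /index_iota subn0; apply: eq_has => u /=.
by rewrite andbC eqb0 negbK.
Qed.

End Run.

(** The input encoding of prescribed colours: 0 means none, and colour d of the
    wheel is shifted by one. *)
Definition code (c : option 'I_6) : nat := if c is Some d then d.+1 else 0.

Lemma code_inj : injective code.
Proof. by case=> [c|] [d|] //= [/val_inj->]. Qed.

Lemma code_lt c : code c < 7.
Proof. by case: c => //= d; rewrite ltnS. Qed.

Definition rim_code k := code (Some (rim k)).

Definition sees_test v k := seen v (rim_code k).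
Definition colour_test v c := Eq (colour_of v) (Const (code (Some c))).

Definition forced_hub_test :=
  Add (colour_test (reg 3) hub)
      (Any [seq Any [seq if C5 k l
                         then And (sees_test (reg 3) k) (sees_test (reg 3) l)
                         else And (colour_test (reg 3) (rim k))
                                  (sees_test (reg 3) l)
                    | l <- enum 'I_5] | k <- enum 'I_5]).

Definition on_rim_test :=
  Any [seq colour_test (reg 3) (rim k) | k <- enum 'I_5].

Definition hit_edge_test :=
  And edge_bit
      (Any [seq And (sees_test (reg 3) k) (sees_test (reg 4) k)
           | k <- enum 'I_5]).

Definition reduction_program :=
  Seq fill_row_starts (Seq fill_seen (Seq (Emit order)
    (Seq (emit_pairs edge_bit) (Seq (emit_vertices forced_hub_test)
      (Seq (emit_vertices on_rim_test) (emit_pairs hit_edge_test)))))).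

Lemma nth_allpairs_const (S T R : Type) (f : S -> T -> R) s t x0 y0 z0 i j :
  i < size s -> j < size t ->
  nth z0 [seq f x y | x <- s, y <- t] (i * size t + j) =
  f (nth x0 s i) (nth y0 t j).
Proof.
elim: s i => //= x s IH [_ jt|i si jt] /=; rewrite nth_cat size_map.
  by rewrite jt (nth_map y0).
by rewrite mulSn -addnA ltnNge leq_addr addKn IH.
Qed.

Section Program.
Variables (n : nat) (G : sgraph 'I_n) (pre : 'I_n -> option 'I_6).

Let w := n :: enc_rel G ++ [seq code (pre v) | v <- enum 'I_n].
Let A x y : bool := nth 0 w (x * n + y).+1 != 0.
Let K v := nth 0 w (n * n + v).+1.

Let size_enum : size (enum 'I_n) = n. Proof. exact: size_enum_ord. Qed.

Let size_rel (r : rel 'I_n) : size (enc_rel r) = n * n.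
Proof. by rewrite size_allpairs !size_enum. Qed.

Let w_adj_ord (x y : 'I_n) : nth 0 w (x * n + y).+1 = G x y.
Proof.
have lt : x * n + y < n * n.
  rewrite (leq_trans _ (leq_mul (ltn_ord x) (leqnn n))) //.
  by rewrite mulSn addnC ltn_add2r.
rewrite /= nth_cat size_rel lt.
have := @nth_allpairs_const _ _ _ (fun x y => nat_of_bool (G x y))
  (enum 'I_n) (enum 'I_n) x y 0 x y.
by rewrite size_enum !nth_ord_enum; apply.
Qed.

Let w_col_ord (v : 'I_n) : nth 0 w (n * n + v).+1 = code (pre v).
Proof.
rewrite /= nth_cat size_rel ltnNge leq_addr /= addKn (nth_map v) ?size_enum //.
by rewrite nth_ord_enum.
Qed.

Let AE (x y : 'I_n) : A x y = G x y.
Proof. by rewrite /A w_adj_ord eqb0 negbK. Qed.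

Let KE (v : 'I_n) : K v = code (pre v). Proof. exact: w_col_ord. Qed.

Let w_adj x y : x < n -> y < n -> nth 0 w (x * n + y).+1 = A x y.
Proof.
move=> xn yn; rewrite (AE (Ordinal xn) (Ordinal yn)).
exact: (w_adj_ord (Ordinal xn) (Ordinal yn)).
Qed.

Let K_lt v : v < n -> K v < 7.
Proof. by move=> vn; rewrite (KE (Ordinal vn)) code_lt. Qed.

Let ready_at m := ready n A K w m.

Lemma ready_rows m : ready_at m -> rows_ok n w n m. Proof. by case. Qed.

Lemma holds_sees m e (x : 'I_n) k : ready_at m -> eval m e = x ->
  holds m (sees_test e k) = sees G pre x k.
Proof.
case=> _ S ex; rewrite /holds.
rewrite -[eval m _]/(m 2 (eval m (times 7 e) + rim_code k)) eval_times ex.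
rewrite S ?code_lt //; apply/hasP/seesP => [[u]|[u xu pu]].
  rewrite mem_iota => /= un /andP[]; rewrite (AE x (Ordinal un)) => xu.
  rewrite (KE (Ordinal un)) => /eqP/code_inj pu; by exists (Ordinal un).
exists (val u); first by rewrite mem_iota /=.
by rewrite AE xu KE pu eqxx.
Qed.

Lemma holds_colour m e (x : 'I_n) c : ready_at m -> eval m e = x ->
  holds m (colour_test e c) = (pre x == Some c).
Proof.
move=> /ready_rows R ex; rewrite holds_Eq (eval_colour_of (K := K) _ _ R ex) //.
by rewrite KE -[eval m (Const _)]/(code (Some c)) (inj_eq code_inj).
Qed.

Lemma holds_forced_hub m (x : 'I_n) : ready_at m -> m 3 0 = x ->
  holds m forced_hub_test = forced_hub G pre x.
Proof.
move=> R mx; have ex : eval m (reg 3) = x := mx.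
rewrite /forced_hub holds_Add (holds_colour _ R ex) holds_Any; congr orb.
have testE k l :
    holds m (if C5 k l then And (sees_test (reg 3) k) (sees_test (reg 3) l)
             else And (colour_test (reg 3) (rim k)) (sees_test (reg 3) l)) =
    if C5 k l then sees G pre x k && sees G pre x l
    else (pre x == Some (rim k)) && sees G pre x l.
  case: ifP => _; rewrite holds_And !(holds_sees _ R ex) //.
  by rewrite (holds_colour _ R ex).
rewrite has_map; apply/hasP/existsP => -[k].
  rewrite /= holds_Any has_map => _ /hasP[l _]; rewrite /= testE => kl.
  by exists k; apply/existsP; exists l.
case/existsP=> l kl; exists k; rewrite ?mem_enum //= holds_Any has_map.
by apply/hasP; exists l; rewrite ?mem_enum //= testE.
Qed.

Lemma holds_on_rim m (x : 'I_n) : ready_at m -> m 3 0 = x ->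
  holds m on_rim_test = on_rim pre x.
Proof.
move=> R mx; have ex : eval m (reg 3) = x := mx.
rewrite holds_Any has_map; apply/hasP/existsP => -[k].
  by rewrite /= (holds_colour _ R ex); exists k.
by move=> kx; exists k; rewrite ?mem_enum //= (holds_colour _ R ex).
Qed.

Lemma eval_edge m (x y : 'I_n) : ready_at m -> m 3 0 = x -> m 4 0 = y ->
  eval m edge_bit = G x y.
Proof.
move=> /ready_rows R mx my; rewrite (eval_edge_bit (A := A) _ R mx my) //.
by rewrite AE.
Qed.

Lemma holds_edge m (x y : 'I_n) : ready_at m -> m 3 0 = x -> m 4 0 = y ->
  holds m edge_bit = G x y.
Proof. by move=> R mx my; rewrite /holds (eval_edge R mx my) eqb0 negbK. Qed.

Lemma holds_hit_edge m (x y : 'I_n) : ready_at m -> m 3 0 = x -> m 4 0 = y ->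
  holds m hit_edge_test = ([set x; y] \in hit_edges G pre).
Proof.
move=> R mx my; have ex : eval m (reg 3) = x := mx.
have ey : eval m (reg 4) = y := my.
rewrite mem_hit_edges holds_And (holds_edge R mx my); congr andb.
rewrite holds_Any has_map; apply/hasP/existsP => -[k].
  by rewrite /= holds_And (holds_sees _ R ex) (holds_sees _ R ey); exists k.
move=> kxy; exists k; rewrite ?mem_enum //=.
by rewrite holds_And (holds_sees _ R ex) (holds_sees _ R ey).
Qed.

(** Invariant of the loop: the tape has grown by a prefix, given by [take], of
    the word to be written. *)
Lemma emit_verticesP e (p : pred 'I_n) :
  (forall m (x : 'I_n), ready_at m -> m 3 0 = x -> holds m e = p x) ->
  forall o1,
    hoare (fun m o => ready_at m /\ o = o1) (emit_vertices e) (n * 3).+2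
      (fun m o => ready_at m /\
                  o = o1 ++ [seq nat_of_bool (p x) | x <- enum 'I_n]).
Proof.
move=> eP o1; set s := map _ _.
have ss : size s = n by rewrite size_map.
pose P i m o := ready_at m /\ o = o1 ++ take i s.
have : hoare (P 0) (emit_vertices e) (n * 3).+2 (P n).
  apply: (@hoare_for P) => // [i m o [R _]|x xn].
    exact: rows_order (ready_rows R).
  apply: hoare_emit => m o [[R ->] mx]; split=> //; split=> //.
  rewrite eval_Truth (eP m (Ordinal xn)) // (take_nth 0) ?ss // rcons_cat.
  rewrite (nth_map (Ordinal xn)) ?size_enum //.
  by have /= -> := nth_ord_enum (Ordinal xn) (Ordinal xn).
move=> run m o [R ->]; case: (run m o1) => [|t [m' [o' [X le [R' o'E]]]]].
  by split=> //; rewrite take0 cats0.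
by rewrite take_oversize ?ss // in o'E; exists t, m', o'.
Qed.

Lemma emit_pairsP e (r : rel 'I_n) :
  (forall m (x y : 'I_n), ready_at m -> m 3 0 = x -> m 4 0 = y ->
    holds m e = r x y) ->
  forall o1,
    hoare (fun m o => ready_at m /\ o = o1) (emit_pairs e) (n * (n * 3).+4).+2
      (fun m o => ready_at m /\ o = o1 ++ enc_rel r).
Proof.
move=> eP o1; rewrite /enc_rel; set s := map _ _.
have ss : size s = n by rewrite size_map.
pose P i m o := ready_at m /\ o = o1 ++ flatten (take i s).
have : hoare (P 0) (emit_pairs e) (n * (n * 3).+4).+2 (P n).
  apply: (@hoare_for P) => // [i m o [R _]|x xn].
    exact: rows_order (ready_rows R).
  pose ox := Ordinal xn.
  pose row := [seq nat_of_bool (r ox y) | y <- enum 'I_n].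
  have rs : size row = n by rewrite size_map.
  pose Q j m o := (ready_at m /\ m 3 0 = x) /\
                  o = o1 ++ flatten (take x s) ++ take j row.
  have : hoare (Q 0) (For 4 order (Emit (Truth e))) (n * 3).+2 (Q n).
    apply: (@hoare_for Q) => // [i m o [[R _] _]|y yn].
      exact: rows_order (ready_rows R).
    apply: hoare_emit => m o [[[R mx] ->] my]; split=> //; split=> //.
    rewrite eval_Truth (eP m ox (Ordinal yn)) // (take_nth 0) ?rs // !rcons_cat.
    rewrite (nth_map (Ordinal yn)) ?size_enum //.
    by have /= -> := nth_ord_enum (Ordinal yn) (Ordinal yn).
  move=> run m o [[R ->] mx]; case: (run m (o1 ++ flatten (take x s))).
    by split=> //; rewrite take0 cats0.
  move=> t [m' [o' [X le [[R' mx'] o'E]]]]; exists t, m', o'; split=> //.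
  split=> //; split=> //; rewrite o'E [take n row]take_oversize ?rs //.
  rewrite (take_nth [::]) ?ss // flatten_rcons (nth_map ox) ?size_enum //.
  by have /= -> := nth_ord_enum ox ox.
move=> run m o [R ->]; case: (run m o1) => [|t [m' [o' [X le [R' o'E]]]]].
  by split=> //; rewrite take0 cats0.
by rewrite take_oversize ?ss // in o'E; exists t, m', o'.
Qed.

Lemma reduction_programP :
  exists t m, exec reduction_program (load w) [::] t m
    (n :: enc_rel G ++ enc_set [set x | forced_hub G pre x] ++
     enc_set [set x | on_rim pre x] ++
     enc_rel [rel x y | [set x; y] \in hit_edges G pre]) /\
    t <= 64 * n.+1 ^ 2.
Proof.
have setE (p : pred 'I_n) :
    enc_set [set x | p x] = [seq nat_of_bool (p x) | x <- enum 'I_n].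
  by apply: eq_map => x; rewrite inE.
rewrite !setE.
have w_col v : v < n -> nth 0 w (n * n + v).+1 = K v by [].
have H1 := @fill_row_startsP n A K w erefl.
have H2 := @fill_seenP n A K w erefl w_adj w_col K_lt.
have H3 : hoare
    (fun m o => [/\ rows_ok n w n m, seen_ok n A K n 0 m & o = [::]])
    (Emit order) 1 (fun m o => ready_at m /\ o = [:: n]).
  apply: hoare_emit => m o [R S ->]; split; first exact: seen_ok_ready.
  by rewrite (rows_order _ R).
have H4 := emit_pairsP holds_edge.
have H5 := emit_verticesP holds_forced_hub.
have H6 := emit_verticesP holds_on_rim.
have H7 := @emit_pairsP _ [rel x y | [set x; y] \in hit_edges G pre]
  holds_hit_edge.
have run := hoare_seq H1 (hoare_seq H2 (hoare_seq H3 (hoare_seq (H4 _)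
  (hoare_seq (H5 _) (hoare_seq (H6 _) (H7 _)))))).
have [t [m [o [X le [_ oE]]]]] := run (load w) [::] (conj erefl erefl).
exists t, m; split; first by move: X; rewrite oE -!catA.
apply: leq_trans le _.
(* The sum is at most 9 n^2 + 21 n + 13. *)
rewrite -mulnn; nia.
Qed.

End Program.

(** * The reduction *)

Definition precolouring (I : w5ext_inst) (v : 'I_(we_n I)) : option 'I_6 :=
  omap (@we_phi I) (insub v).

Definition reduction (I : w5ext_inst) : itte_inst :=
  @ItteInst (we_n I) (we_graph I)
    [set x | forced_hub (we_graph I) (@precolouring I) x]
    [set x | on_rim (@precolouring I) x] _
    (hit_edges_sub (we_graph I) (@precolouring I)).

(** Replacing the dependent function phi on U by a partial colouring. *)
Lemma w5ext_yes_extends I :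
  w5ext_yes I <-> extends_to_W5 (we_graph I) (@precolouring I).
Proof.
split=> -[psi hom ext]; exists psi => //.
  move=> v c; rewrite /precolouring; case: insubP => //= u _ uv [<-].
  by rewrite -uv ext.
by move=> u; apply: ext; rewrite /precolouring valK.
Qed.

Theorem theorem8 :
  exists f : w5ext_inst -> itte_inst,
    polytime_on enc_w5ext enc_itte (fun I => free S211 (we_graph I)) f /\
    forall I : w5ext_inst, free S211 (we_graph I) ->
      free S211 (it_graph (f I)) /\ (w5ext_yes I <-> itte_yes (f I)).
Proof.
exists reduction; split; last first.
  move=> I noF; split=> //; rewrite w5ext_yes_extends; split.
    exact: extends_hub_class.
  exact: hub_class_extends.
exists reduction_program, 64 => I _.
have [t [m [run le]]] := reduction_programP (we_graph I) (@precolouring I).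
exists t, m; split.
  have -> : enc_w5ext I = we_n I :: enc_rel (we_graph I) ++
      [seq code (precolouring v) | v <- enum 'I_(we_n I)].
    congr (_ :: _ ++ _); apply: eq_map => v; rewrite /precolouring.
    by case: (insub v).
  exact: run.
apply: leq_trans le _; rewrite leq_mul2l /=.
have le_n : (we_n I).+1 <= (size (enc_w5ext I)).+1.
  by rewrite ltnS /= size_cat size_map size_enum_ord leqW ?leq_addl.
apply: (@leq_trans ((size (enc_w5ext I)).+1 ^ 2)).
  by rewrite leq_exp2r.
by rewrite leq_pexp2l.
Qed.
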